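(* Let $V$ and $W$ be finite-dimensional complex vector spaces. (i) Let $P: W\otimes V\to V\otimes W$ be a perfect $K$-projector. Then there is a $P$-algebra structure $(\mu,\lambda)$ on $V$ such that the operators $\rho_P(u\otimes x)$, $u\in V$, $x\in V^*$, defined by $$\rho_P(u\otimes x)\,w=(x\otimes \mathrm{id}_W)\,P(w\otimes u),\qquad w\in W,$$ define a representation of the envelope $En(V)$ of the $P$-algebra $(V,\mu,\lambda)$ in $W$. (ii) Given a $P$-algebra structure on $V$ and a representation of $En(V)$ in $W$ obtained as in (i) from a perfect $K$-projector $P$, the $K$-projector $P$ can be reconstructed from them, by the formula $P(w\otimes u)=\sum_j e_j\otimes (u\otimes e^j)\cdot w$, where $e_1,\dots,e_n$ is a basis of $V$ and $e^1,\dots,e^n$ is the dual basis of $V^*$. (iii) Conversely, given an arbitrary $P$-algebra structure on $V$ and an arbitrary representation of $En(V)$ in $W$, the linear map $P: W\otimes V\to V\otimes W$, $P(w\otimes u)=\sum_j e_j\otimes (u\otimes e^j)\cdot w$, makes $V$ a representation of $T^*(W\otimes W^* )$ (an object of $\mathbb{A}_W$) such that $V\otimes V\cong V\oplus V_0$ in $\mathbb{A}_W$, where $V_0$ is a zero representation of $T^*(W\otimes W^* )$. However, $V$ need not be irreducible in general.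
   Context: All vector spaces are finite-dimensional over $\mathbb{C}$ (except free algebras). Associative algebras, coalgebras, their homomorphisms and their representations are not required to be unital/counital. **The category $\mathbb{A}_W$.** For a vector space $W$, $T^*(W\otimes W^* )$ is the free associative algebra generated by $W\otimes W^*$, and $\mathbb{A}_W$ is the category of its finite-dimensional representations. An object $V$ is the same thing as an arbitrary linear map $W\otimes W^*\otimes V\to V$, equivalently an arbitrary linear map $P:W\otimes V\to V\otimes W$ (where $w\otimes\xi\in W\otimes W^*$ acts on $V$ by $v\mapsto(\mathrm{id}_V\otimes\xi)P(w\otimes v)$). The tensor product of $P_1:W\otimes V_1\to V_1\otimes W$ and $P_2:W\otimes V_2\to V_2\otimes W$ is $V_1\otimes V_2$ with the map $$W\otimes V_1\otimes V_2\xrightarrow{P_1\otimes 1}V_1\otimes W\otimes V_2\xrightarrow{1\otimes P_2}V_1\otimes V_2\otimes W.$$ A zero representation is one in which all elements of $W\otimes W^*$ act by zero. $[V]$ denotes the class of $V$ in the Grothendieck group of $\mathbb{A}_W$, with the convention that classes of zero representations are $0$. **$K$-projectors.** A $K$-projector is a linear map $P:W\otimes V\to V\otimes W$ such that $[V\otimes V]=[V]$, where $V$ is regarded as an object of $\mathbb{A}_W$ via $P$. It is called *perfect* if $V$ is an irreducible representation of $T^*(W\otimes W^* )$ and $V\otimes V\cong V\oplus V_0$ where $V_0$ is a zero representation. **$P$-algebras.** A $P$-algebra is a vector space $V$ with linear maps $\mu:V\otimes V\to V$ and $\lambda:V\to V\otimes V$ such that $\mu$ is an associative multiplication, $\lambda$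 is a coassociative comultiplication, and $\mu\circ\lambda=\mathrm{id}_V$. (No compatibility making $V$ a bialgebra is required.) **Envelope.** With $\lambda^*:V^*\otimes V^*\to V^*$ the dual of $\lambda$, the envelope $En(V)$ of a $P$-algebra $V$ is the vector space $V\otimes V^*$ with the associative product $$(u\otimes x)(v\otimes y)=\mu(v\otimes u)\otimes\lambda^*(y\otimes x),\qquad u,v\in V,\ x,y\in V^*.$$ *)

(* Defs.v *)
From HB Require Import structures.
From mathcomp Require Import all_boot all_order all_algebra.

Set Implicit Arguments.
Unset Strict Implicit.
Unset Printing Implicit Defensive.

Import GRing.Theory.
Local Open Scope ring_scope.

Declare Scope tensor_scope.
Delimit Scope tensor_scope with T.
Reserved Notation "V ^*v" (at level 1, format "V ^*v").
Reserved Notation "V ⊗ W" (at level 40, left associativity).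
Reserved Notation "v \ot w" (at level 40, left associativity).

Section Tensor.
Variable K : fieldType.
Implicit Types U V W X Y Z : vectType K.

Lemma linfun_linE (aT rT : vectType K) (f : aT -> rT) :
  linear f -> linfun f =1 f.
Proof.
move=> lin_f x; pose M := GRing.isLinear.Build K aT rT _ f lin_f.
pose g : {linear aT -> rT} := HB.pack f M.
exact: (lfunE g x).
Qed.

Definition dual V : vectType K := 'Hom(V, K^o).

Definition ev V (x : dual V) (v : V) : K := x v.

(* The basis-free model V ⊗ W = Hom(V^*, W), in which v ⊗ w is the map
   x |-> x(v) w; its universal property is tliftE together with tens_ext. *)
Definition tensor V W : vectType K := 'Hom(dual V, W).

Definition tens V W (v : V) (w : W) : tensor V W :=
  linfun (fun x : dual V => ev x v *: w).

(* The linear map V ⊗ W -> X induced by a bilinear b : V -> W -> X. *)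
Definition tlift V W X (b : V -> W -> X) : 'Hom(tensor V W, X) :=
  linfun (fun t : 'Hom(dual V, W) =>
    let e := vbasis {:V} in
    \sum_(i < \dim {:V}) b e`_i (t (linfun (coord e i : V -> K^o)))).

Definition bilin V W X (b : V -> W -> X) : Prop :=
  (forall v, linear (b v)) /\ (forall w, linear (b^~ w)).

Lemma ev_linl V (v : V) : linear (fun x : dual V => ev x v : K^o).
Proof. by move=> a x y; rewrite /ev add_lfunE scale_lfunE. Qed.

Lemma ev_linr V (x : dual V) : linear (fun v => ev x v : K^o).
Proof. by move=> a u v; rewrite /ev linearP. Qed.

Lemma tensE V W (v : V) (w : W) (x : dual V) :
  (tens v w : 'Hom(_, _)) x = ev x v *: w.
Proof.
rewrite /tens linfun_linE // => a y z.
by rewrite ev_linl scalerDl -scalerA.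
Qed.

Lemma bilin_tens V W : bilin (@tens V W).
Proof.
split=> [v a w1 w2|w a v1 v2]; apply/lfunP => x;
  rewrite !(add_lfunE, scale_lfunE, tensE).
  by rewrite scalerDr !scalerA mulrC.
by rewrite ev_linr scalerDl -scalerA.
Qed.

Lemma tlift_lin V W X (b : V -> W -> X) : bilin b ->
  linear (fun t : 'Hom(dual V, W) =>
    let e := vbasis {:V} in
    \sum_(i < \dim {:V}) b e`_i (t (linfun (coord e i : V -> K^o)))).
Proof.
move=> [bl _] a s t /=; rewrite scaler_sumr -big_split /=.
by apply: eq_bigr => i _; rewrite add_lfunE scale_lfunE bl.
Qed.

Lemma ev_coord V n (e : n.-tuple V) i (v : V) :
  ev (linfun (coord e i : V -> K^o)) v = coord e i v.
Proof. by rewrite /ev lfunE. Qed.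

Lemma tliftE V W X (b : V -> W -> X) : bilin b ->
  forall v w, tlift b (tens v w) = b v w.
Proof.
move=> bb v w; rewrite /tlift (linfun_linE (tlift_lin bb)) /=.
have [bl br] := bb.
rewrite {2}(coord_vbasis (memvf v)).
pose M := GRing.isLinear.Build K V X _ (b^~ w) (br w).
pose g : {linear V -> X} := HB.pack (b^~ w) M.
rewrite -[b _ w]/(g _) linear_sum; apply: eq_bigr => i _.
rewrite tensE ev_coord linearZ /=.
pose M' := GRing.isLinear.Build K W X _ _ (bl (vbasis {:V})`_i).
pose h : {linear W -> X} := HB.pack (b (vbasis {:V})`_i) M'.
by rewrite -[LHS]/(h _) linearZ.
Qed.

Lemma tens_decomp V W (t : tensor V W) :
  t = \sum_(i < \dim {:V}) tens (vbasis {:V})`_i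
        ((t : 'Hom(dual V, W)) (linfun (coord (vbasis {:V}) i : V -> K^o))).
Proof.
apply/lfunP => x; rewrite sum_lfunE.
under eq_bigr do rewrite tensE -linearZ.
rewrite -linear_sum; congr (fun_of_lfun _ _); apply/lfunP => v.
rewrite sum_lfunE {1}(coord_vbasis (memvf v)) linear_sum; apply: eq_bigr => i _.
rewrite linearZ scale_lfunE /= lfunE /=.
by rewrite /ev /GRing.scale /= mulrC.
Qed.

Lemma tens_ext V W X (f g : 'Hom(tensor V W, X)) :
  (forall v w, f (tens v w) = g (tens v w)) -> f = g.
Proof.
move=> fg; apply/lfunP => t; rewrite (tens_decomp t) !linear_sum.
by apply: eq_bigr => i _; apply: fg.
Qed.

Definition tmap V W X Y (f : 'Hom(V, X)) (g : 'Hom(W, Y)) :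
    'Hom(tensor V W, tensor X Y) :=
  tlift (fun v w => tens (f v) (g w)).

Definition tassoc U V W :
    'Hom(tensor (tensor U V) W, tensor U (tensor V W)) :=
  tlift (fun t w => tlift (fun u v => tens u (tens v w)) t).

Definition tassoc_inv U V W :
    'Hom(tensor U (tensor V W), tensor (tensor U V) W) :=
  tlift (fun u t => tlift (fun v w => tens (tens u v) w) t).

(* x ⊗ id : V ⊗ W -> K ⊗ W = W and id ⊗ x : V ⊗ W -> V ⊗ K = V. *)
Definition contractl V W (x : dual V) : 'Hom(tensor V W, W) :=
  tlift (fun v w => ev x v *: w).
Definition contractr V W (x : dual W) : 'Hom(tensor V W, V) :=
  tlift (fun v w => ev x w *: v).

Lemma tmapE V W X Y (f : 'Hom(V, X)) (g : 'Hom(W, Y)) v w :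
  tmap f g (tens v w) = tens (f v) (g w).
Proof.
rewrite /tmap tliftE //; have [tl tr] := bilin_tens X Y.
by split=> [u a w1 w2|u a v1 v2]; rewrite linearP ?tl ?tr.
Qed.

Lemma lin_tlift V W X Y (b : X -> V -> W -> Y) :
  (forall x, bilin (b x)) -> (forall v w, linear (fun x => b x v w)) ->
  forall t, linear (fun x => tlift (b x) t).
Proof.
move=> bb bx t a x y; rewrite [t]tens_decomp !linear_sum.
by rewrite -big_split /=; apply: eq_bigr => i _; rewrite !tliftE // bx.
Qed.

Lemma tassocE U V W (u : U) (v : V) (w : W) :
  tassoc U V W (tens (tens u v) w) = tens u (tens v w).
Proof.
have tl A B := (bilin_tens A B).1; have tr A B := (bilin_tens A B).2.
have bb (x : W) : bilin (fun (u : U) (v : V) => tens u (tens v x)).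
  by split=> z a p q; rewrite /= ?tr ?tl.
rewrite /tassoc !tliftE //; split=> [t|x a s t]; last by rewrite linearP.
by apply: lin_tlift => // p q a x y; rewrite !tl.
Qed.

Lemma tassoc_invE U V W (u : U) (v : V) (w : W) :
  tassoc_inv U V W (tens u (tens v w)) = tens (tens u v) w.
Proof.
have tl A B := (bilin_tens A B).1; have tr A B := (bilin_tens A B).2.
have bb (x : U) : bilin (fun (v : V) (w : W) => tens (tens x v) w).
  by split=> z a p q; rewrite /= ?tl ?tr.
rewrite /tassoc_inv !tliftE //; split=> [x a s t|t]; first by rewrite linearP.
by apply: lin_tlift => // p q a x y; rewrite !tr.
Qed.

Lemma contractlE V W (x : dual V) (v : V) (w : W) :
  contractl W x (tens v w) = ev x v *: w.
Proof.
rewrite /contractl tliftE //; split=> [u a w1 w2|u a v1 v2].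
  by rewrite scalerDr !scalerA mulrC.
by rewrite ev_linr scalerDl -scalerA.
Qed.

Lemma contractr_bilin V W (x : dual W) :
  bilin (fun (v : V) (w : W) => ev x w *: v).
Proof.
split=> [u a v1 v2|u a w1 w2].
  by rewrite ev_linr scalerDl -scalerA.
by rewrite scalerDr !scalerA mulrC.
Qed.

Lemma contractrE V W (x : dual W) (v : V) (w : W) :
  contractr V x (tens v w) = ev x w *: v.
Proof. by rewrite /contractr tliftE //; apply: contractr_bilin. Qed.

Lemma contractr_lin V W (t : tensor V W) : linear (fun x => contractr V x t).
Proof.
apply: lin_tlift => [x|v w a x y]; first exact: contractr_bilin.
by rewrite ev_linl scalerDl -scalerA.
Qed.

(* The functional x ⊗ y : V ⊗ W -> K, v ⊗ w |-> x(v) y(w). *)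
Definition tens_fun V W (x : dual V) (y : dual W) : dual (tensor V W) :=
  tlift (fun v w => ev x v * ev y w : K^o).

Lemma tens_fun_bilin V W (x : dual V) (y : dual W) :
  bilin (fun v w => ev x v * ev y w : K^o).
Proof.
split=> [u a v1 v2|u a v1 v2].
  by rewrite ev_linr mulrDr /GRing.scale /= mulrCA.
by rewrite ev_linr mulrDl /GRing.scale /= mulrA.
Qed.

Lemma tens_funE V W (x : dual V) (y : dual W) v w :
  ev (tens_fun x y) (tens v w) = ev x v * ev y w.
Proof. by rewrite /ev /tens_fun tliftE //; apply: tens_fun_bilin. Qed.

Lemma bilin_tens_fun V W : bilin (@tens_fun V W).
Proof.
split=> [x a y z|y a x z]; apply: tens_ext => v w;
  rewrite add_lfunE scale_lfunE -!/(ev _ _) !tens_funE ev_linl.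
  by rewrite mulrDr /GRing.scale /= mulrCA.
by rewrite mulrDl /GRing.scale /= mulrA.
Qed.

End Tensor.

Notation "V ^*v" := (dual V) : tensor_scope.
Notation "V ⊗ W" := (tensor V W) : tensor_scope.
Notation "v \ot w" := (tens v w) : ring_scope.
Bind Scope tensor_scope with Vector.type.

Local Open Scope tensor_scope.
Local Open Scope ring_scope.

Section Representations.
Variable K : fieldType.
Implicit Types G U V W : vectType K.

(* A representation in V of the free associative algebra generated by G is
   a linear map G -> End(V): the action of the generators. *)
Definition frep G V := 'Hom(G, 'End(V)).

Definition subrep G V (rho : frep G V) (U : {vspace V}) : Prop :=
  forall g, (rho g @: U <= U)%VS.

Definition irreducible G V (rho : frep G V) : Prop :=
  {:V}%VS <> 0%VS /\
  forall U : {vspace V}, subrep rho U -> U = 0%VS \/ U = {:V}%VS.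

Definition zero_rep G V (rho : frep G V) : Prop :=
  forall g v, rho g v = 0.

Definition intertwiner G U V (rho : frep G U) (sigma : frep G V)
    (f : 'Hom(U, V)) : Prop :=
  forall g u, f (rho g u) = sigma g (f u).

Definition rep_iso G U V (rho : frep G U) (sigma : frep G V) : Prop :=
  exists2 f : 'Hom(U, V), intertwiner rho sigma f & bijective f.

Definition rep_dsum G U V (rho : frep G U) (sigma : frep G V) :
    frep G (U * V)%type :=
  linfun (fun g => linfun (fun p : U * V => (rho g p.1, sigma g p.2))).

Lemma rep_dsumE G U V (rho : frep G U) (sigma : frep G V) g p :
  rep_dsum rho sigma g p = (rho g p.1, sigma g p.2).
Proof.
have lin2 h : linear (fun p : U * V => (rho h p.1, sigma h p.2)).
  by move=> a q r /=; rewrite !linearP.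
rewrite /rep_dsum linfun_linE ?linfun_linE // => a h k; apply/lfunP => q.
rewrite add_lfunE scale_lfunE !linfun_linE //.
by rewrite !linearP /= !add_lfunE !scale_lfunE.
Qed.

Definition short_exact G U V W (rho : frep G U) (sigma : frep G V)
    (tau : frep G W) (f : 'Hom(U, V)) (g : 'Hom(V, W)) : Prop :=
  [/\ intertwiner rho sigma f, intertwiner sigma tau g,
      lker f = 0%VS, limg f = lker g & limg g = {:W}%VS].

(* Equality of classes in the Grothendieck group modulo the classes of zero
   representations, phrased through the universal property of that group:
   an additive function on objects is a function with values in an abelian
   group that is additive on short exact sequences. *)
Definition additive_fun G (A : zmodType)
    (chi : forall V : vectType K, frep G V -> A) : Prop :=
  forall U V W (rho : frep G U) (sigma : frep G V) (tau : frep G W) f g,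
    short_exact rho sigma tau f g -> chi V sigma = chi U rho + chi W tau.

Definition same_class G U V (rho : frep G U) (sigma : frep G V) : Prop :=
  forall (A : zmodType) (chi : forall V : vectType K, frep G V -> A),
    additive_fun chi ->
    (forall V0 (rho0 : frep G V0), zero_rep rho0 -> chi V0 rho0 = 0) ->
    chi U rho = chi V sigma.

(* The object of A_W given by P : W ⊗ V -> V ⊗ W, as a representation of the
   free algebra on W ⊗ W^*: w ⊗ xi acts by v |-> (id ⊗ xi) P(w ⊗ v). *)
Definition repP W V (P : 'Hom(W ⊗ V, V ⊗ W)) : frep (W ⊗ W^*v) V :=
  tlift (fun w xi => linfun (fun v => contractr V xi (P (w \ot v)))).

Definition tensP W V1 V2 (P1 : 'Hom(W ⊗ V1, V1 ⊗ W))
    (P2 : 'Hom(W ⊗ V2, V2 ⊗ W)) : 'Hom(W ⊗ (V1 ⊗ V2), (V1 ⊗ V2) ⊗ W) :=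
  (tassoc_inv V1 V2 W \o tmap \1 P2 \o tassoc V1 W V2 \o
   tmap P1 \1 \o tassoc_inv W V1 V2)%VF.

Lemma repPE W V (P : 'Hom(W ⊗ V, V ⊗ W)) w xi v :
  repP P (w \ot xi) v = contractr V xi (P (w \ot v)).
Proof.
have tl A B := (@bilin_tens K A B).1; have tr A B := (@bilin_tens K A B).2.
have lin1 x y : linear (fun v => contractr V y (P (x \ot v))).
  by move=> a p q; rewrite tl !linearP.
rewrite /repP tliftE ?(linfun_linE (lin1 _ _)) //.
split=> [x a y z|y a x z]; apply/lfunP => u;
  rewrite add_lfunE scale_lfunE !(linfun_linE (lin1 _ _)).
  by rewrite contractr_lin.
by rewrite tr !linearP.
Qed.

Definition Kprojector W V (P : 'Hom(W ⊗ V, V ⊗ W)) : Prop :=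
  same_class (repP (tensP P P)) (repP P).

(* V ⊗ V is isomorphic to the direct sum of V and a zero representation. *)
Definition square_split W V (P : 'Hom(W ⊗ V, V ⊗ W)) : Prop :=
  exists (V0 : vectType K) (rho0 : frep (W ⊗ W^*v) V0),
    zero_rep rho0 /\ rep_iso (repP (tensP P P)) (rep_dsum (repP P) rho0).

Definition perfect_Kprojector W V (P : 'Hom(W ⊗ V, V ⊗ W)) : Prop :=
  [/\ Kprojector P, irreducible (repP P) & square_split P].

End Representations.

Section Envelope.
Variable K : fieldType.
Implicit Types V W : vectType K.

Record Palgebra V := {
  pmul : 'Hom(V ⊗ V, V);
  pcomul : 'Hom(V, V ⊗ V);
  pmulA : (pmul \o tmap pmul \1 = pmul \o tmap \1 pmul \o tassoc V V V)%VF;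
  pcomulA : (tassoc V V V \o tmap pcomul \1 \o pcomul =
             tmap \1 pcomul \o pcomul)%VF;
  pmulK : (pmul \o pcomul = \1)%VF }.

(* lambda^* : x ⊗ y |-> (x ⊗ y) o lambda *)
Definition dual_comul V (lam : 'Hom(V, V ⊗ V)) : 'Hom(V^*v ⊗ V^*v, V^*v) :=
  tlift (fun x y => (tens_fun x y \o lam)%VF).

Lemma dual_comulE V (lam : 'Hom(V, V ⊗ V)) (x y : V^*v) v :
  ev (dual_comul lam (x \ot y)) v = ev (tens_fun x y) (lam v).
Proof.
rewrite /dual_comul tliftE ?/ev ?comp_lfunE //.
have [tl tr] := @bilin_tens_fun K V V.
by split=> z a p q; apply/lfunP => u;
  rewrite add_lfunE scale_lfunE !comp_lfunE ?tl ?tr add_lfunE scale_lfunE.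
Qed.

(* (u ⊗ x)(v ⊗ y) = mu(v ⊗ u) ⊗ lambda^*(y ⊗ x), see en_mulE *)
Definition en_mul V (A : Palgebra V) (a b : V ⊗ V^*v) : V ⊗ V^*v :=
  tlift (fun u x => tlift (fun v y =>
    pmul A (v \ot u) \ot dual_comul (pcomul A) (y \ot x)) b) a.

Lemma en_mulE V (A : Palgebra V) (u v : V) (x y : V^*v) :
  en_mul A (u \ot x) (v \ot y) =
    pmul A (v \ot u) \ot dual_comul (pcomul A) (y \ot x).
Proof.
have tl X Y := (@bilin_tens K X Y).1; have tr X Y := (@bilin_tens K X Y).2.
have bb p q : bilin (fun (v : V) (y : V^*v) =>
    pmul A (v \ot p) \ot dual_comul (pcomul A) (y \ot q)).
  by split=> z a r s; rewrite tr linearP ?tl ?tr.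
rewrite /en_mul -(tliftE (bb u x)) tliftE //.
split=> z /=; apply: lin_tlift => // p q a r s.
  by rewrite tl linearP tl.
by rewrite tl linearP tr.
Qed.

(* Representation of the (possibly non-unital) algebra En(V) in W. *)
Definition en_rep V (A : Palgebra V) W (rho : 'Hom(V ⊗ V^*v, 'End(W))) : Prop :=
  forall a b, rho (en_mul A a b) = (rho a \o rho b)%VF.

(* rho = rho_P : rho(u ⊗ x) w = (x ⊗ id) P(w ⊗ u) *)
Definition rep_from V W (P : 'Hom(W ⊗ V, V ⊗ W))
    (rho : 'Hom(V ⊗ V^*v, 'End(W))) : Prop :=
  forall u x w, rho (u \ot x) w = contractl W x (P (w \ot u)).

Definition dual_basis V n (e : n.-tuple V) (j : 'I_n) : V^*v :=
  linfun (coord e j : V -> K^o).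

Definition map_from V W (rho : 'Hom(V ⊗ V^*v, 'End(W)))
    (P : 'Hom(W ⊗ V, V ⊗ W)) : Prop :=
  forall (n : nat) (e : n.-tuple V), basis_of {:V} e ->
  forall w u, P (w \ot u) = \sum_(j < n) e`_j \ot rho (u \ot dual_basis e j) w.

End Envelope.

(* Main.v *)
(** The isomorphism V ⊗ V = V ⊕ V_0 provides maps μ : V ⊗ V -> V and
    λ : V -> V ⊗ V with μ λ = 1 such that every generator a of the free algebra
    acts on V ⊗ V as λ a μ, the middle a being its action on V. Pairing with
    functionals turns this identity into
    ρ(u ⊗ x) ρ(v ⊗ y) = ρ(μ(v ⊗ u) ⊗ λ^*(y ⊗ x)), which gives (iii) at once.

    For (i), put μ_1 = μ(μ ⊗ 1), μ_2 = μ(1 ⊗ μ), λ_1 = (λ ⊗ 1)λ and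
    λ_2 = (1 ⊗ λ)λ. Associativity of composition in End(W) gives
    λ_2 a μ_2 = λ_1 a μ_1, so φ = μ_2 λ_1 commutes with the action and
    a μ_2 = φ a μ_1. If V is irreducible and not a zero representation, then φ is
    a scalar c, nonzero because μ_2 is onto, and μ_2 = c μ_1; the pentagon yields
    c^2 = c^3, so μ is associative. Then λ_2 a = λ_1 a for all a, hence
    λ_2 = λ_1. If V is a zero representation then P = 0, and any P-algebra
    structure on V will do. *)

Require Import Defs.
From mathcomp Require Import all_boot all_order all_algebra reals complex.
Set Implicit Arguments.
Unset Strict Implicit.
Unset Printing Implicit Defensive.
Import GRing.Theory.
Local Open Scope ring_scope.
Local Open Scope tensor_scope.

(** * Pure tensors, contractions, and separation of tensors by functionals *)

Section TensorSeparation.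
Variable K : fieldType.
Implicit Types V W X : vectType K.

Lemma tensDl V W (v v' : V) (w : W) : (v + v') \ot w = v \ot w + v' \ot w.
Proof. by have := (bilin_tens V W).2 w 1 v v'; rewrite !scale1r. Qed.

Lemma tensDr V W (v : V) (w w' : W) : v \ot (w + w') = v \ot w + v \ot w'.
Proof. by have := (bilin_tens V W).1 v 1 w w'; rewrite !scale1r. Qed.

Lemma tens0l V W (w : W) : (0 : V) \ot w = 0.
Proof. by apply: (addrI (0 \ot w)); rewrite -tensDl !addr0. Qed.

Lemma tens0r V W (v : V) : v \ot (0 : W) = 0.
Proof. by apply: (addrI (v \ot 0)); rewrite -tensDr !addr0. Qed.

Lemma tensZl V W a (v : V) (w : W) : (a *: v) \ot w = a *: (v \ot w).
Proof. by have := (bilin_tens V W).2 w a v 0; rewrite tens0l !addr0. Qed.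

Lemma tensZr V W a (v : V) (w : W) : v \ot (a *: w) = a *: (v \ot w).
Proof. by have := (bilin_tens V W).1 v a w 0; rewrite tens0r !addr0. Qed.

(** Scalars are absorbed into a factor, so sums of pure tensors exhaust the space. *)
Lemma tens_ind V W (Q : V ⊗ W -> Prop) :
  Q 0 -> (forall s t, Q s -> Q t -> Q (s + t)) -> (forall v w, Q (v \ot w)) ->
  forall t, Q t.
Proof. by move=> Q0 QD Qt t; rewrite [t]tens_decomp; apply: big_ind. Qed.

Lemma ev_ext V (v v' : V) : (forall x : V^*v, ev x v = ev x v') -> v = v'.
Proof.
move=> h; rewrite (coord_vbasis (memvf v)) (coord_vbasis (memvf v')).
by apply: eq_bigr => i _; rewrite -!ev_coord h.
Qed.

(** In the model Hom(V^*, W), contraction is plain evaluation; hence contractions separate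
    tensors. *)
Lemma contractl_eval V W (x : V^*v) (t : V ⊗ W) :
  contractl W x t = (t : 'Hom(_, _)) x.
Proof.
elim/tens_ind: t => [|s t hs ht|v w]; first by rewrite linear0 lfunE.
  by rewrite linearD /= add_lfunE hs ht.
by rewrite contractlE tensE.
Qed.

Lemma contractl_lin V W (t : V ⊗ W) : linear (fun x => contractl W x t).
Proof. by move=> a x y; rewrite !contractl_eval linearP. Qed.

Lemma contractl_inj V W (s t : V ⊗ W) :
  (forall x, contractl W x s = contractl W x t) -> s = t.
Proof. by move=> h; apply/lfunP => x; rewrite -!contractl_eval. Qed.

Lemma ev0 V (x : V^*v) : ev x 0 = 0. Proof. by rewrite /ev linear0. Qed.

Lemma evD V (x : V^*v) (u v : V) : ev x (u + v) = ev x u + ev x v.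
Proof. by rewrite /ev linearD. Qed.

Lemma evZ V (x : V^*v) a (v : V) : ev x (a *: v) = a * ev x v.
Proof. by rewrite /ev linearZ. Qed.

Lemma ev_contract V W (x : V^*v) (y : W^*v) t :
  ev y (contractl W x t) = ev x (contractr V y t).
Proof.
elim/tens_ind: t => [|s t hs ht|v w]; first by rewrite !linear0 !ev0.
  by rewrite !linearD !evD hs ht.
by rewrite contractlE contractrE !evZ mulrC.
Qed.

Lemma contractr_inj V W (s t : V ⊗ W) :
  (forall y, contractr V y s = contractr V y t) -> s = t.
Proof.
move=> h; apply: contractl_inj => x; apply: ev_ext => y.
by rewrite !ev_contract h.
Qed.

Lemma ev_tens_fun V W (x : V^*v) (y : W^*v) t :
  ev (tens_fun x y) t = ev y (contractl W x t).
Proof.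
elim/tens_ind: t => [|s t hs ht|v w]; first by rewrite !linear0 !ev0.
  by rewrite !linearD !evD hs ht.
by rewrite tens_funE contractlE evZ.
Qed.

Lemma tens_fun_ext V W (s t : V ⊗ W) :
  (forall x y, ev (tens_fun x y) s = ev (tens_fun x y) t) -> s = t.
Proof.
move=> h; apply: contractl_inj => x; apply: ev_ext => y.
by rewrite -!ev_tens_fun h.
Qed.

Lemma ev_tens_fun_tmap V V' W W' (f : 'Hom(V, V')) (g : 'Hom(W, W'))
    (x : V'^*v) (y : W'^*v) t :
  ev (tens_fun x y) (tmap f g t) = ev (tens_fun (x \o f)%VF (y \o g)%VF) t.
Proof.
elim/tens_ind: t => [|s t hs ht|v w]; first by rewrite !linear0 !ev0.
  by rewrite !linearD !evD hs ht.
by rewrite tmapE !tens_funE /ev !comp_lfunE.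
Qed.

Lemma basis_contractl V W n (e : n.-tuple V) (t : V ⊗ W) :
  basis_of {:V} e -> t = \sum_(j < n) e`_j \ot contractl W (dual_basis e j) t.
Proof.
move=> be; elim/tens_ind: t => [|s t hs ht|v w].
- by rewrite big1 // => j _; rewrite linear0 tens0r.
- rewrite {1}hs {1}ht -big_split; apply: eq_bigr => j _.
  by rewrite linearD tensDr.
- rewrite {1}(coord_basis be (memvf v)).
  have -> : (\sum_(i < n) coord e i v *: e`_i) \ot w =
            \sum_(i < n) (coord e i v *: e`_i) \ot w.
    by apply: (big_morph (fun u => u \ot w)) => [a b|]; rewrite ?tensDl ?tens0l.
  apply: eq_bigr => j _.
  by rewrite contractlE ev_coord tensZr tensZl.
Qed.

End TensorSeparation.

(** * From [P] to operators on W and back; splittings of V ⊗ V as envelope relations *)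

Section Correspondence.
Variable K : fieldType.
Variables V W : vectType K.
Implicit Types (P : 'Hom(W ⊗ V, V ⊗ W)) (rho : 'Hom(V ⊗ V^*v, 'End(W))).
Implicit Types (mu : 'Hom(V ⊗ V, V)) (lam : 'Hom(V, V ⊗ V)).

Lemma rep_from_exists P : exists rho, rep_from P rho.
Proof.
have lin1 u x : linear (fun w => contractl W x (P (w \ot u))).
  by move=> a v w; rewrite tensDl tensZl !linearP.
exists (tlift (fun u x => linfun (fun w => contractl W x (P (w \ot u))))).
move=> u x w; rewrite tliftE ?(linfun_linE (lin1 _ _)) //.
split=> [v a y z|y a v z]; apply/lfunP => p;
  rewrite add_lfunE scale_lfunE !(linfun_linE (lin1 _ _)).
  by rewrite contractl_lin.
by rewrite tensDr tensZr !linearP.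
Qed.

Lemma map_from_rep_from P rho : rep_from P rho -> map_from rho P.
Proof.
move=> hP n e be w u; rewrite {1}(basis_contractl (P _) be).
by apply: eq_bigr => j _; rewrite hP.
Qed.

(** [P] is built from one fixed basis, but the conclusion is basis-free; [map_from_rep_from] then
    gives the formula in every basis. *)
Lemma map_of_rep_exists rho : exists P, rep_from P rho.
Proof.
pose e := vbasis {:V}.
pose b (w : W) (u : V) := \sum_(j < \dim {:V}) e`_j \ot rho (u \ot dual_basis e j) w.
have bb : bilin b.
  split=> z a p q; rewrite /b scaler_sumr -big_split; apply: eq_bigr => j _ /=.
    by rewrite tensDl tensZl linearP add_lfunE scale_lfunE tensDr tensZr.
  by rewrite linearP tensDr tensZr.
exists (tlift b) => u x w; rewrite tliftE // /b linear_sum.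
(* Expansion of x in the dual basis, which turns the sum defining [b] back into u ⊗ x. *)
have xE : x = \sum_(j < \dim {:V}) ev x e`_j *: dual_basis e j.
  apply/lfunP => v; rewrite sum_lfunE {1}(coord_vbasis (memvf v)) linear_sum.
  apply: eq_bigr => j _; rewrite linearZ scale_lfunE [dual_basis e j v]ev_coord.
  by rewrite /GRing.scale /= mulrC.
have -> : u \ot x = \sum_(j < \dim {:V}) ev x e`_j *: (u \ot dual_basis e j).
  rewrite {1}xE (big_morph (tens u) (tensDr u) (tens0r _ u)).
  by apply: eq_bigr => j _; rewrite tensZr.
rewrite linear_sum sum_lfunE; apply: eq_bigr => j _.
by rewrite /= contractlE linearZ scale_lfunE.
Qed.

(** The scalar obtained by contracting P(w ⊗ u) with x and xi is a matrix coefficient both on V and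
    on W; identities transfer between the two actions through it. *)
Lemma ev_repP P rho w xi u x : rep_from P rho ->
  ev x (repP P (w \ot xi) u) = ev xi (rho (u \ot x) w).
Proof. by move=> hP; rewrite repPE hP ev_contract. Qed.

(** The vector w crosses v first and u second. This order is the source of the reversed factors v ⊗
    u and y ⊗ x in the envelope product. *)
Lemma contractl_tensP P w u v x y :
  contractl W (tens_fun y x) (tensP P P (w \ot (v \ot u))) =
  contractl W x (P (contractl W y (P (w \ot v)) \ot u)).
Proof.
rewrite /tensP !comp_lfunE tassoc_invE tmapE id_lfunE.
elim/tens_ind: (P (w \ot v)) => [|s t hs ht|p q].
- by rewrite tens0l !linear0 tens0l !linear0.
- by rewrite tensDl !linearD /= hs ht tensDl !linearD.
rewrite tassocE tmapE id_lfunE contractlE tensZl !linearZ /=.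
elim/tens_ind: (P (q \ot u)) => [|s t hs ht|p' q'].
- by rewrite tens0r !linear0.
- by rewrite tensDr !linearD /= hs ht.
by rewrite tassoc_invE !contractlE tens_funE scalerA.
Qed.

Lemma ev_repP_tensP P rho w xi u v x y : rep_from P rho ->
  ev (tens_fun y x) (repP (tensP P P) (w \ot xi) (v \ot u)) =
  ev xi (rho (u \ot x) (rho (v \ot y) w)).
Proof. by move=> hP; rewrite repPE -ev_contract contractl_tensP !hP. Qed.

(** Both identities have the same matrix coefficients: those for w ⊗ xi, v ⊗ u and y ⊗ x on V ⊗ V
    are those for w and xi on W. *)
Lemma repP_split P rho mu lam : rep_from P rho ->
  (forall g t, repP (tensP P P) g t = lam (repP P g (mu t))) <->
  (forall u v x y, rho (mu (v \ot u) \ot dual_comul lam (y \ot x)) =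
     (rho (u \ot x) \o rho (v \ot y))%VF).
Proof.
move=> hP; split=> h.
  move=> u v x y; apply/lfunP => w; apply: ev_ext => xi.
  by rewrite comp_lfunE -(ev_repP_tensP _ _ _ _ _ _ hP) h -dual_comulE (ev_repP _ _ _ _ hP).
elim/tens_ind => [t|g g' hg hg' t|w xi].
- by rewrite !linear0 !lfunE /= linear0.
- by rewrite !linearD !add_lfunE hg hg' linearD.
elim/tens_ind => [|s t hs ht|v u]; first by rewrite !linear0.
  by rewrite !linearD /= hs ht.
apply: tens_fun_ext => y x.
by rewrite (ev_repP_tensP _ _ _ _ _ _ hP) -dual_comulE (ev_repP _ _ _ _ hP) h comp_lfunE.
Qed.

Lemma en_rep_tens (A : Palgebra V) rho :
  en_rep A rho <->
  (forall u v x y,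
    rho (pmul A (v \ot u) \ot dual_comul (pcomul A) (y \ot x)) =
     (rho (u \ot x) \o rho (v \ot y))%VF).
Proof.
split=> [h u v x y|h]; first by rewrite -en_mulE h.
move=> a b.
have bb p q : bilin (fun (v : V) (y : V^*v) =>
    pmul A (v \ot p) \ot dual_comul (pcomul A) (y \ot q)).
  by split=> z c r s; rewrite ?tensDl ?tensDr ?tensZl ?tensZr linearP
    ?tensDl ?tensDr ?tensZl ?tensZr.
elim/tens_ind: a => [|s t hs ht|u x].
- by rewrite /en_mul !linear0 comp_lfun0l.
- by rewrite /en_mul !linearD comp_lfunDl; congr (_ + _).
have enE c : en_mul A (u \ot x) c = tlift (fun v y =>
    pmul A (v \ot u) \ot dual_comul (pcomul A) (y \ot x)) c.
  rewrite /en_mul tliftE //.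
  split=> z /=; apply: lin_tlift => // p q d r s;
  by rewrite ?tensDl ?tensDr ?tensZl ?tensZr linearP
    ?tensDl ?tensDr ?tensZl ?tensZr.
rewrite enE.
elim/tens_ind: b => [|s t hs ht|v y].
- by rewrite !linear0 comp_lfun0r.
- by rewrite !linearD comp_lfunDr -hs -ht.
by rewrite tliftE.
Qed.

(** Take V_0 = ker μ, with inverse isomorphisms t ↦ (μ t, t - λ μ t) and (v, k) ↦ λ v + k. The
    action on V ⊗ V factors through μ, so it kills V_0. *)
Lemma square_split_of_section P mu lam : (mu \o lam = \1)%VF ->
  (forall g t, repP (tensP P P) g t = lam (repP P g (mu t))) -> square_split P.
Proof.
move=> mulam PP.
have muK v : mu (lam v) = v by rewrite -comp_lfunE mulam id_lfunE.
have kerP t : t - lam (mu t) \in lker mu.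
  by rewrite memv_ker linearB /= muK subrr.
exists (subvs_of (lker mu)), 0; split=> [g v|]; first by rewrite !lfunE.
pose f t := (mu t, vsproj (lker mu) (t - lam (mu t))).
have lin_f : linear f.
  move=> a s t; rewrite /f; congr pair; first by rewrite linearP.
  by rewrite !(linearP mu) (linearP lam) opprD addrACA -scalerBr linearP.
exists (linfun f) => [g t|]; rewrite ?(linfun_linE lin_f).
  rewrite rep_dsumE /f PP muK subrr linear0.
  by rewrite !lfunE.
exists (fun p : V * subvs_of (lker mu) => lam p.1 + vsval p.2).
  by move=> t; rewrite (linfun_linE lin_f) /= vsprojK // addrC subrK.
move=> [v k]; rewrite (linfun_linE lin_f) /f /= linearD /= muK.
have /eqP -> : mu (vsval k) == 0 by rewrite -memv_ker subvsP.
by rewrite addr0 addrC addKr vsvalK.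
Qed.

(** μ is the isomorphism followed by the projection to V, and λ is the inclusion of V followed by
    the inverse. As V_0 has zero action, only the V component of an image survives. *)
Lemma section_of_square_split P : square_split P -> exists mu lam,
  (mu \o lam = \1)%VF /\
  (forall g t, repP (tensP P P) g t = lam (repP P g (mu t))).
Proof.
move=> [V0 [rho0 [rho0_eq0 [f f_hom f_bij]]]].
have f_inj : lker f == 0%VS by apply/lker0P/bij_inj.
(* Bijectivity provides a bare function as inverse; it serves to show that the linear inverse is
   two-sided. *)
have fK : cancel f^-1%VF f.
  by case: f_bij => h _ hK p; rewrite -[p in LHS]hK lker0_lfunK // hK.
have lin_fst : linear (fun p : V * V0 => p.1) by [].
have lin_inl : linear (fun v : V => (v, 0 : V0)).
  by move=> a u v; congr pair; rewrite /= scaler0 addr0.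
exists (linfun (fun p : V * V0 => p.1) \o f)%VF.
exists (f^-1 \o linfun (fun v : V => (v, 0 : V0)))%VF.
split.
  by apply/lfunP => v; rewrite !comp_lfunE fK (linfun_linE lin_inl) (linfun_linE lin_fst) id_lfunE.
move=> g t; rewrite !comp_lfunE (linfun_linE lin_inl) (linfun_linE lin_fst).
apply: (lker0P f_inj); rewrite f_hom fK rep_dsumE.
by rewrite rho0_eq0.
Qed.

End Correspondence.

(** * Irreducible representations with nonzero action *)

Section Irreducible.
Variable K : fieldType.
Variables (G V : vectType K) (sigma : frep G V).
Hypothesis irr_sigma : irreducible sigma.

(** The kernel of f - h contains every vector g v, so it is a subrepresentation; it is nonzero
    because the action is, hence it is all of V. *)
Lemma irreducible_hom_ext (X : vectType K) (f h : 'Hom(V, X)) :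
  ~ zero_rep sigma -> (forall g v, f (sigma g v) = h (sigma g v)) -> f = h.
Proof.
move=> nz fh; have [_ /(_ (lker (f - h)))] := irr_sigma.
have inU g v : sigma g v \in lker (f - h).
  by rewrite memv_ker add_lfunE opp_lfunE fh subrr.
case=> [g|U0|UV].
- by apply/subvP => _ /memv_imgP[v _ ->]; apply: inU.
- by case: nz => g v; apply/eqP; rewrite -memv0 -U0.
apply/lfunP => v; apply/eqP; rewrite -subr_eq0 -opp_lfunE -add_lfunE -memv_ker.
by rewrite UV memvf.
Qed.

(** The line through a vector killed by all generators is a subrepresentation; were it all of V, the
    action would be zero. *)
Lemma irreducible_faithful v :
  ~ zero_rep sigma -> (forall g, sigma g v = 0) -> v = 0.
Proof.
move=> nz v0; have [_ /(_ <[v]>%VS)] := irr_sigma.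
case=> [g|U0|UV].
- by apply/subvP => _ /memv_imgP[_ /vlineP[k ->] ->]; rewrite linearZ /= v0 scaler0 mem0v.
- by apply/eqP; rewrite -memv0 -U0 memv_line.
case: nz => g u; have := memvf u; rewrite -UV => /vlineP[k ->].
by rewrite linearZ /= v0 scaler0.
Qed.

End Irreducible.

(** * Eigenvectors and Schur's lemma over an algebraically closed field *)

Section Schur.
Import VectorInternalTheory.
Variable K : closedFieldType.

Lemma eigenvector_exists (V : vectType K) (f : 'End(V)) :
  {:V}%VS <> 0%VS -> exists a v, v <> 0 /\ f v = a *: v.
Proof.
move=> V_neq0.
have [a] : exists a, root (char_poly (f2mx f)) a.
  (* The characteristic polynomial has degree dim V > 0, so it is not constant. *)
  apply/closed_rootP; rewrite size_char_poly; apply/eqP => -[dim0].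
  by apply/V_neq0/eqP; rewrite -dimv_eq0 dimvf dim0.
rewrite -eigenvalue_root_char => /eigenvalueP[v fv v_neq0].
exists a, (r2v v); split; last by rewrite unlock /= r2vK fv linearZ.
by move=> rv0; case/eqP: v_neq0; rewrite -[v]r2vK rv0 linear0.
Qed.

(** An eigenspace of an intertwiner is a nonzero subrepresentation, hence everything. *)
Lemma schur (G V : vectType K) (sigma : frep G V) (phi : 'End(V)) :
  irreducible sigma -> intertwiner sigma sigma phi ->
  exists c, forall v, phi v = c *: v.
Proof.
move=> [V_neq0 irr] hom; have [c [v [v_neq0 vc]]] := eigenvector_exists phi V_neq0.
exists c => u.
have kerE x : (x \in lker (phi - c *: \1%VF)) = (phi x == c *: x).
  by rewrite memv_ker add_lfunE opp_lfunE scale_lfunE id_lfunE subr_eq0.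
case: (irr (lker (phi - c *: \1%VF))) => [g|U0|UV].
- apply/subvP => _ /memv_imgP[x + ->]; rewrite !kerE => /eqP xc.
  by rewrite hom xc linearZ.
- by case: v_neq0; apply/eqP; rewrite -memv0 -U0 kerE vc.
by apply/eqP; rewrite -kerE UV memvf.
Qed.

End Schur.

(** * Rebracketing, and the constant in associativity up to a scalar *)

Section Associators.
Variable K : fieldType.
Variable V : vectType K.
Implicit Types (mu : 'Hom(V ⊗ V, V)) (lam : 'Hom(V, V ⊗ V)).

Lemma tassocK (X Y Z : vectType K) : cancel (tassoc X Y Z) (tassoc_inv X Y Z).
Proof.
elim/tens_ind => [|s t hs ht|t z]; first by rewrite !linear0.
  by rewrite !linearD /= hs ht.
elim/tens_ind: t => [|s t hs ht|x y]; first by rewrite tens0l !linear0.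
  by rewrite tensDl !linearD /= hs ht.
by rewrite tassocE tassoc_invE.
Qed.

Lemma tmapK (X X' Y Y' : vectType K) (f : 'Hom(X, X')) (f' : 'Hom(X', X))
    (g : 'Hom(Y, Y')) (g' : 'Hom(Y', Y)) :
  cancel f f' -> cancel g g' -> cancel (tmap f g) (tmap f' g').
Proof.
move=> fK gK; elim/tens_ind => [|s t hs ht|x y]; first by rewrite !linear0.
  by rewrite !linearD /= hs ht.
by rewrite !tmapE fK gK.
Qed.

Lemma ev_tens_fun_tassoc (X Y Z : vectType K) (x : X^*v) (y : Y^*v) (z : Z^*v) t :
  ev (tens_fun x (tens_fun y z)) (tassoc X Y Z t) =
  ev (tens_fun (tens_fun x y) z) t.
Proof.
elim/tens_ind: t => [|s t hs ht|t w]; first by rewrite !linear0 !ev0.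
  by rewrite !linearD !evD hs ht.
elim/tens_ind: t => [|s t hs ht|u v]; first by rewrite tens0l !linear0 !ev0.
  by rewrite tensDl !linearD !evD hs ht.
by rewrite tassocE !tens_funE mulrA.
Qed.

Lemma dual_comul_tens lam (x y : V^*v) :
  dual_comul lam (x \ot y) = (tens_fun x y \o lam)%VF.
Proof. by apply/lfunP => v; rewrite -!/(ev _ _) dual_comulE /ev comp_lfunE. Qed.

(** Since μ is onto, every vector is a sum of products. *)
Lemma section_ind mu lam (Q : V -> Prop) : (mu \o lam = \1)%VF ->
  Q 0 -> (forall u v, Q u -> Q v -> Q (u + v)) ->
  (forall u v, Q (mu (u \ot v))) -> forall v, Q v.
Proof.
move=> mulam Q0 QD Qmu v; rewrite -[v]id_lfunE -mulam comp_lfunE.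
elim/tens_ind: (lam v) => [|s t hs ht|x y] //; first by rewrite linear0.
by rewrite linearD; apply: QD.
Qed.

(* The pentagon: rebracketing x(y(zt)) as ((xy)z)t takes two or three steps
   according to the route, so c^2 = c^3. *)
Lemma assoc_constant_eq1 mu lam (c : K) : (mu \o lam = \1)%VF ->
  {:V}%VS <> 0%VS -> c != 0 ->
  (forall x y z, mu (x \ot mu (y \ot z)) = c *: mu (mu (x \ot y) \ot z)) ->
  c = 1.
Proof.
move=> mulam V_neq0 c_neq0 assoc; apply: contra_not_eq V_neq0 => c_neq1.
have prod4 x y z t : mu (mu (mu (x \ot y) \ot z) \ot t) = 0.
  have : mu (x \ot mu (y \ot mu (z \ot t))) =
         (c * c) *: mu (mu (mu (x \ot y) \ot z) \ot t).
    by rewrite assoc assoc scalerA.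
  rewrite [mu (y \ot _)]assoc tensZr linearZ /= assoc.
  rewrite [mu (x \ot mu (y \ot z))]assoc tensZl !linearZ /= !scalerA.
  move/eqP; rewrite -subr_eq0 -scalerBl -{2}[c * c]mulr1 -mulrBr scaler_eq0.
  by rewrite !mulf_eq0 (negPf c_neq0) subr_eq0 (negPf c_neq1) => /eqP.
(* If c ≠ 1, fourfold products vanish; as μ is onto, so do threefold and twofold products, and
   finally V itself. *)
have prod3 x z t : mu (mu (x \ot z) \ot t) = 0.
  move: x; apply: (section_ind mulam) => [|u v hu hv|u v] //.
    by rewrite tens0l linear0 tens0l linear0.
  by rewrite tensDl linearD tensDl linearD /= hu hv addr0.
have prod2 x t : mu (x \ot t) = 0.
  move: x; apply: (section_ind mulam) => [|u v hu hv|u v] //.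
    by rewrite tens0l linear0.
  by rewrite tensDl linearD /= hu hv addr0.
apply/eqP; rewrite -subv0; apply/subvP => v _; rewrite memv0; apply/eqP.
by move: v; apply: (section_ind mulam) => [|u v -> ->|u v] //; rewrite addr0.
Qed.

End Associators.

(** * Associativity and coassociativity for a perfect projector *)

Section PerfectProjector.
Variable K : closedFieldType.
Variables V W : vectType K.
Variable P : 'Hom(W ⊗ V, V ⊗ W).
Variables (mu : 'Hom(V ⊗ V, V)) (lam : 'Hom(V, V ⊗ V)).
Hypothesis mulam : (mu \o lam = \1)%VF.
Hypothesis P_split :
  forall g t, repP (tensP P P) g t = lam (repP P g (mu t)).

Let mul2 := (mu \o tmap \1 mu)%VF.
Let mul1 := (mu \o tmap mu \1 \o tassoc_inv V V V)%VF.
Let comul2 := (tmap \1 lam \o lam)%VF.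
Let comul1 := (tassoc V V V \o tmap lam \1 \o lam)%VF.

Let mulamK : cancel lam mu.
Proof. by move=> v; rewrite -comp_lfunE mulam id_lfunE. Qed.

Let mul2E x y z : mul2 (x \ot (y \ot z)) = mu (x \ot mu (y \ot z)).
Proof. by rewrite /mul2 comp_lfunE tmapE id_lfunE. Qed.

Let mul1E x y z : mul1 (x \ot (y \ot z)) = mu (mu (x \ot y) \ot z).
Proof. by rewrite /mul1 !comp_lfunE tassoc_invE tmapE id_lfunE. Qed.

Let mul2K : cancel comul2 mul2.
Proof.
move=> v; rewrite /comul2 /mul2 !comp_lfunE tmapK ?mulamK //.
by move=> x; rewrite !id_lfunE.
Qed.

Let mul1K : cancel comul1 mul1.
Proof.
move=> v; rewrite /comul1 /mul1 !comp_lfunE tassocK tmapK ?mulamK //.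
by move=> x; rewrite !id_lfunE.
Qed.

(* Both sides are the coefficients of a product of three operators of the
   envelope; they agree because composition in End(W) is associative. *)
Lemma triple_action g t :
  comul2 (repP P g (mul2 t)) = comul1 (repP P g (mul1 t)).
Proof.
have [rho hP] := rep_from_exists P.
have rhoM := (repP_split mu lam hP).1 P_split.
elim/tens_ind: g t => [t|g g' hg hg' t|w xi].
- by rewrite !linear0 !lfunE /= !linear0.
- by rewrite linearD !add_lfunE (linearD comul2) (linearD comul1) /= hg hg'.
elim/tens_ind => [|s t hs ht|x t]; first by rewrite !linear0.
  by rewrite !linearD /= hs ht.
elim/tens_ind: t => [|s t hs ht|y z]; first by rewrite tens0r !linear0.
  by rewrite tensDr !linearD /= hs ht.
rewrite mul1E mul2E.
apply: contractl_inj => x'; apply: tens_fun_ext => y' z'.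
rewrite -!ev_tens_fun /comul1 /comul2 !comp_lfunE ev_tens_fun_tassoc.
rewrite !ev_tens_fun_tmap !comp_lfun1r -!dual_comul_tens -!dual_comulE.
by rewrite !(ev_repP _ _ _ _ hP) !rhoM comp_lfunA.
Qed.

Lemma perfect_associative : irreducible (repP P) -> ~ zero_rep (repP P) ->
  mul2 = mul1 /\ comul2 = comul1.
Proof.
move=> irr nz.
have actE g t : repP P g (mul2 t) = mul2 (comul1 (repP P g (mul1 t))).
  by rewrite -triple_action mul2K.
have [|c phiE] := @schur _ _ _ (repP P) (mul2 \o comul1)%VF irr.
  (* Putting t = [comul1] v in [actE] shows that the composite commutes with the action. *)
  by move=> g v; rewrite !(comp_lfunE mul2 comul1) actE mul1K.
have mul2_mul1 t : mul2 t = c *: mul1 t.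
  apply/eqP; rewrite -subr_eq0; apply/eqP.
  apply: (irreducible_faithful irr nz) => g.
  by rewrite linearB linearZ /= actE -phiE (comp_lfunE mul2 comul1) subrr.
have assoc x y z : mu (x \ot mu (y \ot z)) = c *: mu (mu (x \ot y) \ot z).
  by rewrite -mul2E mul2_mul1 mul1E.
have c1 : c = 1.
  (* If c = 0 then [mul2] = 0, although [comul2] is a section of it; so V would be zero. *)
  apply: (assoc_constant_eq1 mulam irr.1 _ assoc); apply/eqP => c0.
  apply: irr.1; apply/eqP; rewrite -subv0; apply/subvP => v _.
  by rewrite memv0 -[v]mul2K mul2_mul1 c0 scale0r.
have mulE : mul2 = mul1 by apply/lfunP => t; rewrite mul2_mul1 c1 scale1r.
(* It suffices to compare the comultiplications on vectors g v, and v = [mul2] ([comul2] v) brings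
   these under [triple_action]. *)
split=> //; apply: (irreducible_hom_ext irr nz) => g v.
by rewrite -[v]mul2K triple_action -mulE.
Qed.

Lemma perfect_Palgebra : irreducible (repP P) -> ~ zero_rep (repP P) ->
  exists A : Palgebra V, pmul A = mu /\ pcomul A = lam.
Proof.
move=> irr nz; have [mulE comulE] := perfect_associative irr nz.
have muA : (mu \o tmap mu \1 = mu \o tmap \1 mu \o tassoc V V V)%VF.
  rewrite -/mul2 mulE; apply/lfunP => t.
  by rewrite /mul1 !comp_lfunE tassocK.
by exists (@Build_Palgebra _ _ mu lam muA (esym comulE) mulam).
Qed.

End PerfectProjector.

(** * A family of P-algebras and a reducible example *)

Section LeftZero.
Variable K : fieldType.
Variable V : vectType K.
Variables (x0 : V^*v) (e : V).
Hypothesis x0e : ev x0 e = 1.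

Let left_zero_comul : 'Hom(V, V ⊗ V) := linfun (fun v => v \ot e).

Let left_zero_comulE v : left_zero_comul v = v \ot e.
Proof. by rewrite linfun_linE //; apply: (bilin_tens V V).2. Qed.

(** Any bracketing of x y z gives x_0(y) x_0(z) x, and x_0(e) = 1 makes λ a section of μ. The
    structure serves both as the reducible example and as a P-algebra on an arbitrary nonzero
    space. *)
Lemma left_zero_Palgebra : exists A : Palgebra V,
  (forall u v, pmul A (u \ot v) = ev x0 v *: u) /\
  (forall v, pcomul A v = v \ot e).
Proof.
pose mu := contractr V x0; pose lam := left_zero_comul.
have muA : (mu \o tmap mu \1 = mu \o tmap \1 mu \o tassoc V V V)%VF.
  apply/lfunP; elim/tens_ind => [|s t hs ht|t z]; first by rewrite !linear0.
    by rewrite !linearD /= hs ht.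
  elim/tens_ind: t => [|s t hs ht|x y]; first by rewrite tens0l !linear0.
    by rewrite tensDl !linearD /= hs ht.
  rewrite !comp_lfunE tassocE !tmapE !id_lfunE !contractrE evZ.
  by rewrite scalerA mulrC.
have lamA : (tassoc V V V \o tmap lam \1 \o lam = tmap \1 lam \o lam)%VF.
  apply/lfunP => v.
  by rewrite !comp_lfunE !left_zero_comulE !tmapE !left_zero_comulE !id_lfunE tassocE.
have muK : (mu \o lam = \1)%VF.
  by apply/lfunP => v; rewrite comp_lfunE left_zero_comulE contractrE x0e scale1r id_lfunE.
exists (Build_Palgebra muA lamA muK); split=> [u v|v] /=.
  exact: contractrE.
exact: left_zero_comulE.
Qed.

(** On the one-dimensional W, u ⊗ x acts by the scalar x_0(u) x(e). Then w ⊗ xi sends v to x_0(v)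
    xi(w) e, so the line through e is a proper subrepresentation, with nonzero action on e. *)
Lemma left_zero_reducible : {:V}%VS <> <[e]>%VS ->
  exists (A : Palgebra V) (rho : 'Hom(V ⊗ V^*v, 'End(K^o)))
    (P : 'Hom(K^o ⊗ V, V ⊗ K^o)),
  [/\ en_rep A rho, map_from rho P, ~ zero_rep (repP P)
    & ~ irreducible (repP P)].
Proof.
move=> V_neq; have [A [muE lamE]] := left_zero_Palgebra.
pose b (u : V) (x : V^*v) : 'End(K^o) := (ev x0 u * ev x e) *: \1%VF.
have bb : bilin b.
  split=> z a p q; rewrite /b scalerA -scalerDl; congr (_ *: _).
    by rewrite ev_linl mulrDr mulrCA.
  by rewrite ev_linr mulrDl -mulrA.
pose rho := tlift b; have rhoE u x : rho (u \ot x) = b u x := tliftE bb u x.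
have [P hP] := map_of_rep_exists rho.
have PE w xi v : repP P (w \ot xi) v = (ev x0 v * ev xi w) *: e.
  apply: ev_ext => x; rewrite (ev_repP _ _ _ _ hP) rhoE /b.
  by rewrite scale_lfunE id_lfunE !evZ mulrAC.
exists A, rho, P; split.
- apply/en_rep_tens => u v x y; rewrite !rhoE; apply/lfunP => w.
  rewrite comp_lfunE /b !scale_lfunE !id_lfunE scalerA muE evZ dual_comulE.
  by rewrite lamE tens_funE [ev y e * _]mulrC mulrACA.
- exact: map_from_rep_from.
- move=> /(_ ((1 : K^o) \ot \1%VF) e); rewrite PE x0e /ev id_lfunE mul1r scale1r.
  by move=> e0; move: x0e; rewrite e0 ev0 => /eqP; rewrite eq_sym oner_eq0.
- move=> [_ /(_ <[e]>%VS)[]] //.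
  + elim/tens_ind => [|g g' hg hg'|w xi].
    * by rewrite linear0 lim0g sub0v.
    * by apply/subvP => _ /memv_imgP[v vU ->]; rewrite linearD add_lfunE memvD //;
        [apply: (subvP hg)|apply: (subvP hg')]; apply: memv_img.
    * by apply/subvP => _ /memv_imgP[v _ ->]; rewrite PE memvZ ?memv_line.
  + move=> e0; have := memv_line e; rewrite e0 memv0 => /eqP e_eq0.
    by move: x0e; rewrite e_eq0 ev0 => /eqP; rewrite eq_sym oner_eq0.
  + by move=> /esym.
Qed.

End LeftZero.

(** * Zero actions and the proof of the theorem *)

Lemma dual_vector_exists (K : fieldType) (V : vectType K) (e : V) :
  e != 0 -> exists x : V^*v, ev x e = 1.
Proof.
move=> e_neq0; have [i ci] : exists i, coord (vbasis {:V}) i e != 0.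
  apply/existsP; apply: contraNT e_neq0 => /existsPn e0.
  rewrite (coord_vbasis (memvf e)) big1 // => i _.
  by move/negPn/eqP: (e0 i) => ->; rewrite scale0r.
exists ((coord (vbasis {:V}) i e)^-1 *: dual_basis (vbasis {:V}) i).
by rewrite /ev scale_lfunE -/(ev _ _) ev_coord /GRing.scale /= mulVf.
Qed.

Lemma Palgebra_inhabited (K : fieldType) (V : vectType K) :
  {:V}%VS <> 0%VS -> inhabited (Palgebra V).
Proof.
move=> /eqP; rewrite -vpick0 => /dual_vector_exists[x xe].
by have [A _] := left_zero_Palgebra xe; constructor.
Qed.

Lemma zero_repP (K : fieldType) (V W : vectType K) (P : 'Hom(W ⊗ V, V ⊗ W)) :
  zero_rep (repP P) -> P = 0.
Proof.
move=> P0; apply: tens_ext => w v; rewrite lfunE /=; apply: contractr_inj => xi.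
by rewrite -repPE P0 linear0.
Qed.

(** A zero action amounts to P = 0, which is decidable; this makes the case distinction
    constructive. *)
Lemma zero_rep_dec (K : fieldType) (V W : vectType K) (P : 'Hom(W ⊗ V, V ⊗ W)) :
  zero_rep (repP P) \/ ~ zero_rep (repP P).
Proof.
have [->|P0] := eqVneq P 0; last by right=> /zero_repP /eqP; apply/negP.
left; elim/tens_ind => [|g g' hg hg'|w xi] v; first by rewrite linear0 lfunE.
  by rewrite linearD add_lfunE hg hg' addr0.
by rewrite repPE lfunE /= linear0.
Qed.

Theorem theorem2 (R : realType) (V W : vectType R[i]) :
  (forall P : 'Hom(W ⊗ V, V ⊗ W), perfect_Kprojector P ->
     exists (A : Palgebra V) (rho : 'Hom(V ⊗ V^*v, 'End(W))),
       rep_from P rho /\ en_rep A rho)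
  /\
  (forall (A : Palgebra V) (rho : 'Hom(V ⊗ V^*v, 'End(W)))
          (P : 'Hom(W ⊗ V, V ⊗ W)),
     perfect_Kprojector P -> en_rep A rho -> rep_from P rho ->
     map_from rho P)
  /\
  (forall (A : Palgebra V) (rho : 'Hom(V ⊗ V^*v, 'End(W))),
     en_rep A rho ->
     exists P : 'Hom(W ⊗ V, V ⊗ W), map_from rho P /\ square_split P)
  /\
  (exists (V' W' : vectType R[i]) (A : Palgebra V')
          (rho : 'Hom(V' ⊗ V'^*v, 'End(W'))) (P : 'Hom(W' ⊗ V', V' ⊗ W')),
     [/\ en_rep A rho, map_from rho P, ~ zero_rep (repP P)
       & ~ irreducible (repP P)]).
Proof.
split=> [P [_ irr split_P]|].
  have [P0|nz] := zero_rep_dec P.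
    (* Here P = 0, so ρ_P = 0 represents the envelope of any P-algebra on V. *)
    have [A] := Palgebra_inhabited irr.1; exists A, 0.
    split=> [u x w|a b]; last by rewrite !zero_lfunE comp_lfun0l.
    by rewrite (zero_repP P0) !zero_lfunE linear0.
  have [mu [lam [mulam P_split]]] := section_of_square_split split_P.
  have [A [muE lamE]] := perfect_Palgebra mulam P_split irr nz.
  have [rho hP] := rep_from_exists P; exists A, rho; split=> //.
  by apply/en_rep_tens; rewrite muE lamE; apply/(repP_split mu lam hP).
split=> [A rho P _ _|]; first exact: map_from_rep_from.
split=> [A rho /en_rep_tens rhoM|].
  have [P hP] := map_of_rep_exists rho; exists P; split; first exact: map_from_rep_from.
  apply: (square_split_of_section (pmulK A)).
  exact/(repP_split (pmul A) (pcomul A) hP).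
(* The plane is the smallest space in which the line through e is proper; (0, 1) lies outside it. *)
pose V' : vectType R[i] := (R[i]^o * R[i]^o)%type.
pose e : V' := (1, 0).
have e_neq0 : e != 0 by apply/eqP => -[/eqP]; rewrite oner_eq0.
have [x xe] := dual_vector_exists e_neq0.
exists V', R[i]^o; apply: (left_zero_reducible xe) => V'e.
have : (0, 1) \in <[e]>%VS by rewrite -V'e memvf.
case/vlineP => k [_ /eqP]; rewrite scaler0 oner_eq0 //.
Qed.
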